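(* Let $r > 2$ and $n > r$ be integers, and define the real number $\delta$ by $\mathrm{cp}(n-1,r-1) = \delta\,\mathrm{cp}(n,r)$. Then \[ \mathrm{cp}(n,r)\binom{\delta n}{r} \le \binom{n}{r}. \] Consequently, for each fixed $r \ge 2$, as $n \to \infty$, \[ \mathrm{cp}(n,r) \ge (1-o(1))\,n^{r/2}. \]
   Context: $[n] = \{1,\dots,n\}$ and $\binom{X}{r}$ denotes the family of $r$-element subsets of $X$. For integers $n \ge r \ge 2$, a clique partition of $\binom{[n]}{r}$ is a collection of proper subsets $A_1,\dots,A_t \subsetneq [n]$ such that the families $\binom{A_i}{r}$ partition $\binom{[n]}{r}$ (every $r$-subset of $[n]$ lies in exactly one $A_i$). $\mathrm{cp}(n,r)$ is the minimum size $t$ of such a clique partition. For real $x$ and positive integer $r$, $\binom{x}{r} = x(x-1)\cdots(x-r+1)/r!$. *)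

(* Defs.v *)
From HB Require Import structures.
From mathcomp Require Import all_boot all_order all_algebra.
Set Implicit Arguments.
Unset Strict Implicit.
Unset Printing Implicit Defensive.
Import GRing.Theory.

(* The set {0, ..., n-1} = 'I_n plays the role of [n]. A collection
   A_1, ..., A_t is a set of sets: a repeated A_i with at least r elements
   would violate uniqueness, and an A_i with fewer than r elements contains no
   r-subset, so indexed families give the same minimum size. *)
Definition clique_partition (n r : nat) (P : {set {set 'I_n}}) : bool :=
  [forall A in P, A \proper [set: 'I_n]] &&
  [forall B : {set 'I_n}, (#|B| == r) ==> (#|[set A in P | B \subset A]| == 1)].

Definition subsets_of_card (n r : nat) : {set {set 'I_n}} :=
  [set B : {set 'I_n} | #|B| == r].

(* The arg min needs a feasible starting point: for r < n the family of all
   r-subsets is a clique partition. For n = r there is no clique partition and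
   the value is meaningless. *)
Definition cp (n r : nat) : nat :=
  #|[arg min_(P < subsets_of_card n r | clique_partition r P) #|P| ]|.

Lemma subsets_of_card_clique_partition (n r : nat) :
  r < n -> clique_partition r (subsets_of_card n r).
Proof.
move=> rn; apply/andP; split.
  apply/forallP => A; apply/implyP; rewrite inE => /eqP Ar.
  rewrite properE subsetT /=; apply/negP => /subset_leq_card.
  by rewrite cardsT card_ord Ar leqNgt rn.
apply/forallP => B; apply/implyP => /eqP Br.
rewrite (_ : [set A in _ | _] = [set B]) ?cards1 //.
apply/setP => A; rewrite !inE; apply/andP/eqP => [[/eqP Ar BA]|->].
  by apply/esym/eqP; rewrite eqEcard BA Ar Br leqnn.
by rewrite Br.
Qed.

Lemma cpP (n r : nat) : r < n ->
  (exists2 P : {set {set 'I_n}}, clique_partition r P & #|P| = cp n r) /\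
  (forall P : {set {set 'I_n}}, clique_partition r P -> cp n r <= #|P|).
Proof.
move=> rn; rewrite /cp.
case: arg_minnP => [|P Pcp Pmin]; first exact: subsets_of_card_clique_partition.
by split; [exists P | exact: Pmin].
Qed.

Local Open Scope ring_scope.

Definition binomr (R : numFieldType) (x : R) (r : nat) : R :=
  (\prod_(i < r) (x - i%:R)) / (r`!)%:R.

(* Main.v *)
Require Import Defs.
From HB Require Import structures.
From mathcomp Require Import all_boot all_order all_algebra.
From mathcomp Require Import all_classical all_reals all_analysis.
From mathcomp Require Import fintype finset ring lra.
Set Implicit Arguments.
Unset Strict Implicit.
Unset Printing Implicit Defensive.
Import Order.TTheory GRing.Theory Num.Theory.
Import numFieldNormedType.Exports.
Local Open Scope ring_scope.

(* Removing a point v from the blocks through v of a clique partition for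
   (n, r) gives a clique partition for (n - 1, r - 1), so v lies in at least
   cp(n-1, r-1) blocks and the average block size is at least delta n. Since
   the blocks A satisfy sum_A 'C(#|A|, r) = 'C(n, r), the first inequality is
   Jensen's inequality: 'C(a, r) lies above the tangents of binomr at every
   x >= r - 1; for x <= r one simply has binomr x r <= 1.

   With s = sqrt n the asymptotic bound is proved in the explicit form
   cp(n, r) >= s^r - C s^(r-1), by induction on r from Fisher's inequality
   cp(n, 2) >= n. If cp(n, r) = u^r with u <= s, the first part and the
   induction hypothesis give
   s^(r-1) - O(s^(r-2)) <= cp(n-1, r-1) <= u^(r-1) + (r-1) u^r / n
                        <= u s^(r-2) + O(s^(r-2)),
   hence u >= s - O(1). *)

(** * Links of points and double counting in clique partitions *)

Lemma clique_partition_proper n r (P : {set {set 'I_n}}) A :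
  clique_partition r P -> A \in P -> exists x, x \notin A.
Proof.
move=> /andP[/forall_inP Pprop _] /Pprop; rewrite properE subsetT /=.
by case/subsetPn => x _ xA; exists x.
Qed.

Lemma clique_partition_card n r (P : {set {set 'I_n}}) (B : {set 'I_n}) :
  clique_partition r P -> #|B| = r -> #|[set A in P | B \subset A]| = 1%N.
Proof.
by move=> /andP[_ /forallP/(_ B)/implyP h] Br; apply/eqP/h/eqP.
Qed.

Lemma cp_le_degree m r (P : {set {set 'I_m.+1}}) (v : 'I_m.+1) : (r < m)%N ->
  clique_partition r.+1 P -> (cp m r <= #|[set A in P | v \in A]|)%N.
Proof.
move=> rm Pcp; set D := [set A in P | _].
pose link (A : {set 'I_m.+1}) := [set i | lift v i \in A].
have [_ /(_ (link @: D)) cpmin] := cpP rm.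
apply: leq_trans (cpmin _) (leq_imset_card _ _).
apply/andP; split.
  apply/forall_inP => _ /imsetP[A /[!inE] /andP[AP vA] ->].
  (* A point [x] missed by [A] differs from [v], so it survives in the link and keeps [link A]
     proper. *)
  have [x xA] := clique_partition_proper Pcp AP.
  rewrite properE subsetT; apply/subsetPn.
  have [i xE|xv] := unliftP v x; last by rewrite xv vA in xA.
  by exists i; rewrite // inE -xE.
apply/forallP => B; apply/implyP => /eqP Br.
have vB : #|v |: lift v @: B| = r.+1.
  rewrite cardsU1 card_imset ?Br; last exact: lift_inj.
  rewrite (_ : v \notin _) //; apply/imsetP => -[i _ /eqP].
  by rewrite (negPf (neq_lift v i)).
(* The only block containing [v] and the copy of [B] gives the only link containing [B]. *)
have /eqP/cards1P[A0 A0E] := clique_partition_card Pcp vB.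
suff -> : [set C in link @: D | B \subset C] = link @: [set A0].
  by rewrite imset_set1 cards1.
have linkS (A : {set _}) : v \in A ->
    (B \subset link A) = (v |: lift v @: B \subset A).
  move=> vA; rewrite subUset sub1set vA /=; apply/subsetP/subsetP => h x.
    by move=> /imsetP[i /h /[!inE] ? ->].
  by move=> xB; rewrite inE h // imset_f.
rewrite -A0E; apply/setP => C; rewrite inE; apply/andP/imsetP.
  move=> [/imsetP[A /[!inE] /andP[AP vA] ->]]; rewrite linkS // => h.
  by exists A; rewrite // inE AP.
case=> A /[!inE] /andP[AP BA] ->.
have vA : v \in A by rewrite (subsetP BA) ?setU11.
by rewrite linkS ?BA ?imset_f // inE AP.
Qed.

Lemma sum_degree n (P : {set {set 'I_n}}) :
  (\sum_(A in P) #|A| = \sum_v #|[set A in P | v \in A]|)%N.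
Proof.
under eq_bigr => A _ do rewrite -sum1_card.
rewrite (exchange_big_dep predT) //=; apply: eq_bigr => v _.
by rewrite -sum1dep_card.
Qed.

(** Double counting of the pairs of an [r]-set [B] and a block [A] containing it: each [B] occurs
    once. *)
Lemma sum_bin_card n r (P : {set {set 'I_n}}) :
  clique_partition r P -> (\sum_(A in P) 'C(#|A|, r) = 'C(n, r))%N.
Proof.
move=> Pcp; under eq_bigr => A _ do rewrite -cards_draws -sum1dep_card.
rewrite (exchange_big_dep (fun B : {set 'I_n} => #|B| == r)) /=; last first.
  by move=> A B _ /andP[].
rewrite -[n in RHS]card_ord -card_draws -sum1dep_card.
apply: eq_bigr => B Br.
rewrite -[RHS](clique_partition_card Pcp (eqP Br)) -sum1dep_card.
by apply: eq_bigl => A; rewrite Br andbT.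
Qed.

(** * Tangents of the falling factorial *)

Lemma falling_tangent (R : realFieldType) (r : nat) (x : R) : r.-1%:R <= x ->
  [/\ 0 <= \prod_(i < r) (x - i%:R) & exists2 s : R, 0 <= s & forall a : nat,
    \prod_(i < r) (x - i%:R) + s * (a%:R - x) <= (a ^_ r)%:R].
Proof.
elim: r => [|r IHr] /= rx.
  split; first by rewrite big_ord0 ler01.
  by exists 0 => // a; rewrite big_ord0 mul0r addr0 ffactn0.
have /IHr[] : r.-1%:R <= x by apply: le_trans rx; rewrite ler_nat leq_pred.
rewrite big_ord_recr /=; set f := \prod_(_ < _) _ => f0 [s s0 fs].
have xr : 0 <= x - r%:R by rewrite subr_ge0.
split; first exact: mulr_ge0.
(* The slope is the derivative, by the product rule. For [r <= a], multiplying the previous tangent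
   bound by [a - r] exceeds the new tangent by [s * (a - x) ^+ 2]. *)
exists (f + s * (x - r%:R)) => [|a]; first by rewrite addr_ge0 ?mulr_ge0.
have [ra|ar] := leqP r a.
  rewrite ffactnSr natrM natrB //.
  have ra' : 0 <= a%:R - r%:R :> R by rewrite subr_ge0 ler_nat.
  apply: le_trans (ler_wpM2r ra' (fs a)).
  have := mulr_ge0 s0 (sqr_ge0 (a%:R - x)); lra.
(* For [a < r] the falling factorial vanishes and the tangent is
   [f * (a - r) + s * (x - r) * (a - x) <= 0]. *)
rewrite ffact_small ?(ltn_trans ar) //.
have ar' : 0 <= r%:R - a%:R :> R by rewrite subr_ge0 ler_nat ltnW.
have := mulr_ge0 f0 ar'; have := mulr_ge0 (mulr_ge0 s0 xr) ar'.
have := mulr_ge0 (mulr_ge0 s0 xr) xr; lra.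
Qed.

Lemma falling_norm_le (R : realFieldType) (r : nat) (x : R) : 0 <= x <= r%:R ->
  `|\prod_(i < r) (x - i%:R)| <= r`!%:R.
Proof.
elim: r => [|r IHr] /andP[x0 xr]; first by rewrite big_ord0 normr1.
have [xr'|/ltW rx] := leP x r%:R.
  rewrite big_ord_recr /= normrM factS natrM mulrC ler_pM // ?IHr ?x0 //.
  rewrite ler_norml; apply/andP; split; lra.
(* For [r <= x <= r + 1], compare with the tangent at [x] evaluated at [a = r + 1]. *)
have [f0 [s s0 /(_ r.+1)]] := @falling_tangent R r.+1 x rx.
rewrite ger0_norm // ffactnn; apply: le_trans; rewrite lerDl mulr_ge0 //; lra.
Qed.

(** * The first inequality *)

Lemma cp_gt0 n r : (r < n)%N -> (0 < cp n r)%N.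
Proof.
move=> rn; have [[P Pcp <-] _] := cpP rn.
rewrite lt0n cards_eq0; apply/negP => /eqP P0.
have := sum_bin_card Pcp; rewrite P0 big_set0 => /esym/eqP.
by rewrite -leqn0 leqNgt bin_gt0 ltnW.
Qed.

Lemma cp_le_bin n r : (r < n)%N -> (cp n r <= 'C(n, r))%N.
Proof.
move=> rn; have [_ /(_ _ (subsets_of_card_clique_partition rn))] := cpP rn.
by rewrite /subsets_of_card card_draws card_ord.
Qed.

Lemma cp_binomr_le (R : realFieldType) (r n : nat) (delta : R) : (0 < r)%N ->
  (r < n)%N -> (cp n.-1 r.-1)%:R = delta * (cp n r)%:R ->
  (cp n r)%:R * binomr (delta * n%:R) r <= 'C(n, r)%:R.
Proof.
case: r n => // r [//|n] _ rn /= deltaE.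
have cp0 : 0 < (cp n.+1 r.+1)%:R :> R by rewrite ltr0n cp_gt0.
have delta0 : 0 <= delta by rewrite -(pmulr_lge0 _ cp0) -deltaE.
set x := delta * _; have x0 : 0 <= x by rewrite mulr_ge0.
have fact0 : 0 < r.+1`!%:R :> R by rewrite ltr0n fact_gt0.
have [xr|/ltW rx] := leP x r.+1%:R.
  apply: (@le_trans _ _ (cp n.+1 r.+1)%:R); last by rewrite ler_nat cp_le_bin.
  apply: ler_piMr; first exact: ltW.
  rewrite /binomr ler_pdivrMr // mul1r.
  by rewrite (le_trans (ler_norm _)) // falling_norm_le ?x0.
have [|f0 [s s0 tangent]] := @falling_tangent R r.+1 x.
  by apply: le_trans rx; rewrite ler_nat.
have [[P Pcp Pcard] _] := cpP rn.
rewrite /binomr mulrA ler_pdivrMr // -natrM bin_ffact.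
have -> : (n.+1 ^_ r.+1)%:R = \sum_(A in P) (#|A| ^_ r.+1)%:R :> R.
  rewrite -bin_ffact -(sum_bin_card Pcp) -natr_sum big_distrl /=.
  by congr (_%:R); apply: eq_bigr => A _; rewrite bin_ffact.
move: tangent; set f := \prod_(_ < _) _ => tangent.
have : \sum_(A in P) (f + s * (#|A|%:R - x)) <= \sum_(A in P) (#|A| ^_ r.+1)%:R.
  by apply: ler_sum.
apply: le_trans.
rewrite big_split /= -mulr_sumr sumr_const Pcard mulr_natl lerDl mulr_ge0 //.
(* The linear terms have nonnegative sum: [x * cp n r] is [n * cp (n-1) (r-1)], at most the sum of
   all degrees. *)
rewrite sumrB sumr_const Pcard -[x *+ _]mulr_natl subr_ge0 -natr_sum sum_degree.
rewrite mulrCA mulrA -deltaE mulrC -!natrM ler_nat.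
rewrite -[X in (X * _)%N]card_ord -sum_nat_const; apply: leq_sum => v _.
exact: cp_le_degree.
Qed.

(** * Fisher's inequality *)

Lemma cp_fisher n : (2 < n)%N -> (n <= cp n 2)%N.
Proof.
move=> n2; have [[P Pcp <-] _] := cpP n2.
(* The point-block incidence matrix; once its rows are independent, there are at least as many
   blocks as points. *)
pose M : 'M[rat]_(n, #|P|) :=
  \matrix_(i < n, j < #|P|) (i \in (enum_val j : {set 'I_n}))%:R.
suff /eqP ME : row_free M by rewrite -[leqLHS]ME rank_leq_col.
apply: inj_row_free => x xM0.
have pairP (i j : 'I_n) : i != j ->
    #|[set A in P | (i \in A) && (j \in A)]| = 1%N.
  move=> ij; rewrite -(@clique_partition_card n 2 P [set i; j]) ?cards2 ?ij //.
  by apply: eq_card => A; rewrite !inE subUset !sub1set.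
have x0 A : A \in P -> \sum_(i in A) x 0 i = 0.
  move=> AP; have /rowP/(_ (enum_rank_in AP A)) := xM0.
  rewrite !mxE => E; rewrite -[RHS]E big_mkcond /=; apply: eq_bigr => i _.
  by rewrite mxE enum_rankK_in //; case: ifP; rewrite ?mulr1 ?mulr0.
pose d i := #|[set A in P | i \in A]|.
(* A block [A] through [i] misses some [k], and the block through [i] and [k] is a second one. *)
have d2 i : (1 < d i)%N.
  have coverP j : i != j -> exists A, [&& A \in P, i \in A & j \in A].
    by move=> /pairP/eqP/cards1P[A /setP/(_ A) /[!inE] /[!eqxx]]; exists A.
  have /card_gt0P[j /[!inE] ji] : (0 < #|[set~ i]|)%N.
    by rewrite cardsC1 card_ord -subn1 subn_gt0 ltnW.
  have [A /and3P[AP iA jA]] := coverP j (contra_neq esym ji).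
  have [k kA] := clique_partition_proper Pcp AP.
  have [|B /and3P[BP iB kB]] := coverP k; first by apply: contraNneq kA => <-.
  have AB : A != B by apply: contraNneq kA => ->.
  apply: leq_trans (_ : #|[set A; B]| <= _)%N; first by rewrite cards2 AB.
  apply: subset_leq_card; apply/subsetP => C.
  by rewrite !inE => /orP[] /eqP ->; rewrite ?AP ?BP.
(* Sum the equations [\sum_(j in A) x j = 0] over the blocks [A] through [i]. *)
have xS i : x 0 i * (d i).-1%:R = - \sum_j x 0 j.
  have : \sum_(A in P | i \in A) \sum_(j in A) x 0 j = 0.
    by rewrite big1 // => A /andP[/x0].
  rewrite (exchange_big_dep predT) //= (bigD1 i) //= => xi0.
  have xi : \sum_(A in P | (i \in A) && (i \in A)) x 0 i =
      x 0 i * (d i).-1%:R + x 0 i.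
    rewrite mulr_natr -mulrSr prednK ?(ltnW (d2 i)) // -sumr_const.
    by apply: eq_bigl => A; rewrite inE andbb.
  have xj j : j != i ->
      \sum_(A in P | (i \in A) && (j \in A)) x 0 j = x 0 j.
    rewrite eq_sym => ij; rewrite -[RHS]mulr1n -[X in _ *+ X](pairP i j ij).
    rewrite -sumr_const.
    by apply: eq_bigl => A; rewrite inE.
  rewrite [in RHS](bigD1 i) //=; move: xi0.
  rewrite -(eq_bigl _ _ (fun A => andbA _ _ _)) xi.
  under eq_bigr => j ji do rewrite -(eq_bigl _ _ (fun A => andbA _ _ _)) xj //.
  lra.
have S0 : \sum_j x 0 j = 0.
  set S := \sum_j _.
  have d0 i : 0 < (d i).-1%:R :> rat by rewrite ltr0n -subn1 subn_gt0.
  (* Solve [xS] for [x 0 i] and sum over [i]; the second factor is positive. *)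
  have : S * (1 + \sum_i ((d i).-1%:R)^-1) = 0.
    rewrite mulrDr mulr1 mulr_sumr {1}/S -big_split big1 //= => i _.
    by rewrite -[S]opprK -(xS i) mulNr mulfK ?gt_eqF // subrr.
  move/eqP; rewrite mulf_eq0 => /orP[/eqP //|].
  by rewrite gt_eqF // ltr_wpDr // sumr_ge0 // => i _; rewrite invr_ge0 ltW.
apply/rowP => i; rewrite mxE; apply/eqP.
have /eqP := xS i; rewrite S0 oppr0 mulf_eq0 pnatr_eq0 => /orP[//|].
by case: (d i) (d2 i) => [|[]].
Qed.

(** * The asymptotic bound *)

Local Open Scope classical_set_scope.

(** Bernoulli's inequality for [1 - k / s], cleared of denominators. *)
Lemma subr_bernoulli (R : realFieldType) (s k : R) (r : nat) : 0 <= k <= s ->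
  s ^+ r.+1 - r.+1%:R * k * s ^+ r <= (s - k) ^+ r.+1.
Proof.
move=> /andP[k0 ks]; have s0 := le_trans k0 ks.
elim: r => [|r IHr]; first by rewrite !expr1 expr0 mulr1 mul1r.
have sk0 : 0 <= s - k by rewrite subr_ge0.
rewrite [leRHS]exprSr; apply: le_trans (ler_wpM2r sk0 IHr).
have := mulr_ge0 (ler0n R r.+1) (mulr_ge0 (sqr_ge0 k) (exprn_ge0 r s0)).
rewrite -[r.+2%:R]natr1 !exprS; nra.
Qed.

Lemma expr_sub_le_falling (R : realFieldType) (r : nat) (x : R) :
  r%:R <= x -> (x - r%:R) ^+ r.+1 <= \prod_(i < r.+1) (x - i%:R).
Proof.
move=> rx; rewrite -[in leLHS](card_ord r.+1) -prodr_const.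
by apply: ler_prod => i _; rewrite subr_ge0 rx lerB // ler_nat -ltnS.
Qed.

(** With [x = delta * n], the first inequality yields [u ^+ r.+1 * (x - r) ^+ r.+1 <= n ^+ r.+1].
    Taking roots bounds [x], and [cp (n-1) r] is [x * u ^+ r.+1 / n]. *)
Lemma cp_link_le (R : realFieldType) (r n : nat) (u : R) : (r.+1 < n)%N ->
  0 < u -> u ^+ r.+1 = (cp n r.+1)%:R ->
  (cp n.-1 r)%:R <= u ^+ r + r%:R * u ^+ r.+1 / n%:R.
Proof.
move=> rn u0 uE; have n0 : 0 < n%:R :> R by rewrite ltr0n (leq_ltn_trans _ rn).
have t0 : 0 < u ^+ r.+1 by rewrite exprn_gt0.
set t' : R := (cp n.-1 r)%:R; set x := t' / u ^+ r.+1 * n%:R.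
suff ux : u * (x - r%:R) <= n%:R.
  have -> : t' = x * u ^+ r.+1 / n%:R.
    by rewrite /x; field; rewrite !gt_eqF ?exprn_gt0.
  rewrite ler_pdivrMr // mulrDl divfK ?gt_eqF // [u ^+ r.+1]exprS.
  have : 0 <= u ^+ r * (n%:R - u * (x - r%:R)).
    by rewrite mulr_ge0 ?exprn_ge0 ?(ltW u0) // subr_ge0.
  lra.
have [xr|rx] := ltP x r%:R.
  by apply: le_trans (ltW n0); rewrite pmulr_rle0 // subr_le0 ltW.
rewrite -(@ler_pXn2r _ r.+1) ?nnegrE ?(ltW n0) ?mulr_ge0 ?(ltW u0) ?subr_ge0 //.
rewrite exprMn; apply: le_trans (ler_wpM2l (ltW t0) (expr_sub_le_falling rx)) _.
have /= := @cp_binomr_le R r.+1 n (t' / u ^+ r.+1) isT rn.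
rewrite -uE mulfVK ?gt_eqF // => /(_ erefl).
rewrite /binomr mulrA ler_pdivrMr ?ltr0n ?fact_gt0 // => /le_trans; apply.
rewrite -natrM bin_ffact -natrX ler_nat ffact_prod.
rewrite -[in leqRHS](card_ord r.+1) -prod_nat_const.
by apply: leq_prod => i _; rewrite leq_subr.
Qed.

Lemma cp_ge_expr (R : realType) (r : nat) : exists2 C : R, 0 <= C &
  forall n, (r.+2 < n)%N ->
    Num.sqrt n%:R ^+ r.+2 - C * Num.sqrt n%:R ^+ r.+1 <= (cp n r.+2)%:R.
Proof.
elim: r => [|r [C C0 IHr]].
  by exists 0 => // n n2; rewrite mul0r subr0 sqr_sqrtr ?ler_nat ?cp_fisher.
(* One [r.+2] pays for replacing [n] by [n-1], the other for the error term of [cp_link_le], and [C]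
   comes from the induction hypothesis. *)
pose K := 2 * r.+2%:R + C; have K0 : 0 <= K by rewrite addr_ge0 ?mulr_ge0.
exists (r.+3%:R * K) => [|n rn]; first exact: mulr_ge0.
set s : R := Num.sqrt _.
have s1 : 1 <= s by rewrite -[leLHS]sqrtr1 ler_wsqrtr // ler1n (leq_trans _ rn).
have s0 : 0 <= s by apply: le_trans s1.
have [sK|/ltW Ks] := leP s K.
  apply: le_trans (_ : 0 <= _) => //.
  rewrite subr_le0 exprS ler_wpM2r ?exprn_ge0 //.
  by apply: le_trans sK _; rewrite ler_peMl // ler1n.
have [|tn] := leP (s ^+ r.+3) (cp n r.+3)%:R.
  by apply: le_trans; rewrite gerBl mulr_ge0 ?(exprn_ge0 _ s0) ?mulr_ge0.
(* By Bernoulli it remains to show [s - K <= u], where [u] is the [r.+3]-th root of [cp n r.+3]. *)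
apply: le_trans (_ : (s - K) ^+ r.+3 <= _).
  by rewrite subr_bernoulli // K0.
pose u : R := (cp n r.+3)%:R `^ r.+3%:R^-1.
have uE : u ^+ r.+3 = (cp n r.+3)%:R.
  by rewrite -powR_mulrn ?powR_ge0 // -powRrM mulVf ?powRr1 ?pnatr_eq0.
have u0 : 0 < u by rewrite powR_gt0 // ltr0n cp_gt0.
have us : u <= s by rewrite -(@ler_pXn2r _ r.+3) ?nnegrE ?(ltW u0) // uE ltW.
rewrite -uE ler_pXn2r ?nnegrE ?(ltW u0) ?subr_ge0 //.
have s2 : s ^+ 2 = n%:R by rewrite sqr_sqrtr.
have := cp_link_le rn u0 uE.
have /IHr : (r.+2 < n.-1)%N by rewrite -ltnS prednK // (leq_ltn_trans _ rn).
set s' : R := Num.sqrt _ => lo hi.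
have s's : s' <= s by rewrite ler_wsqrtr // ler_nat leq_pred.
have s'0 : 0 <= s' by exact: sqrtr_ge0.
(* Since [1 <= s], one has [(s - 1) ^+ 2 <= s ^+ 2 - 1 = n - 1]. *)
have ss' : s - 1 <= s'.
  rewrite -(@ler_pXn2r _ 2) ?nnegrE ?subr_ge0 // sqr_sqrtr //.
  rewrite -subn1 natrB ?(leq_ltn_trans _ rn) // -s2; nra.
have := @subr_bernoulli R s 1 r.+1; rewrite ler01 s1 => /(_ isT) bern.
have lo' : s ^+ r.+2 - (r.+2%:R + C) * s ^+ r.+1 <= (cp n.-1 r.+2)%:R.
  have h1 : s' ^+ r.+1 <= s ^+ r.+1 by rewrite lerXn2r ?nnegrE.
  have h2 : (s - 1) ^+ r.+2 <= s' ^+ r.+2 by rewrite lerXn2r ?nnegrE ?subr_ge0.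
  have := ler_wpM2l C0 h1; lra.
have hi' : (cp n.-1 r.+2)%:R <= u * s ^+ r.+1 + r.+2%:R * s ^+ r.+1.
  apply: (le_trans hi); rewrite lerD //.
    by rewrite exprS ler_wpM2l ?(ltW u0) // lerXn2r ?nnegrE ?(ltW u0).
  (* As [u <= s] and [n = s ^+ 2], the quotient [u ^+ r.+3 / n] is at most [s ^+ r.+1]. *)
  rewrite -mulrA ler_wpM2l // ler_pdivrMr ?ltr0n ?(leq_ltn_trans _ rn) //.
  by rewrite -s2 -exprD addn2 lerXn2r ?nnegrE ?(ltW u0).
have sr0 : 0 < s ^+ r.+1 by rewrite exprn_gt0 // (lt_le_trans ltr01).
rewrite -(ler_pM2r sr0) mulrBl -exprS; move: lo' hi'; rewrite /K; lra.
Qed.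

Lemma cvg_sqrt_inv (R : realType) :
  Num.sqrt (n%:R^-1 : R) @[n --> \oo] --> (0 : R).
Proof.
rewrite -[X in _ --> X]sqrtr0.
apply: (@continuous_cvg _ _ _ _ _ (fun n : nat => n%:R^-1 : R) Num.sqrt).
  exact: sqrt_continuous.
apply/gtr0_cvgV0; last exact: cvgr_idn.
by near=> n; rewrite ltr0n; near: n; exists 1%N.
Unshelve. all: by end_near.
Qed.

Theorem theorem2 (R : realType) :
  (forall (r n : nat) (delta : R),
     (2 < r)%N -> (r < n)%N ->
     (cp n.-1 r.-1)%:R = delta * (cp n r)%:R ->
     (cp n r)%:R * binomr (delta * n%:R) r <= ('C(n, r))%:R) /\
  (forall r : nat, (2 <= r)%N ->
     exists e : nat -> R,
       (e n @[n --> \oo] --> (0 : R)) /\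
       (forall n : nat, (r < n)%N ->
          (1 - e n) * (n%:R `^ (r%:R / 2)) <= (cp n r)%:R)).
Proof.
split=> [r n delta r2|[|[|r]] // _].
  exact/cp_binomr_le/(leq_trans _ r2).
have [C _ cpC] := cp_ge_expr R r.
(* The error [C * s ^+ r.+1] relative to [s ^+ r.+2], for [s] the square root of [n]. *)
exists (fun n => C * Num.sqrt n%:R^-1); split.
  by rewrite -[X in _ --> X](mulr0 C); apply: cvgMl_tmp; exact: cvg_sqrt_inv.
move=> n rn; apply: le_trans (cpC n rn).
have s0 : 0 < Num.sqrt n%:R :> R.
  by rewrite sqrtr_gt0 ltr0n (leq_ltn_trans _ rn).
rewrite [_ / 2]mulrC powRrM powR12_sqrt // powR_mulrn ?(ltW s0) //.
rewrite sqrtrV // mulrBl mul1r [_ ^+ r.+2]exprS -mulrA mulKf ?gt_eqF //.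
Qed.
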